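(* The following hold. (1) If $\mathcal{C}$ is a complex functor, then its monad completion $\mathcal{C}^{\infty}$ is a complex monad. (2) The monad completion map $(-)^{\infty} : \mathbf{CF} \to \mathbf{CF}$ is a closure operator (monotone, increasing, idempotent) whose image is $\mathbf{CM}$. Consequently, $\mathbf{CM}$ is a complete lattice under the inherited order and meet and the induced join. (3) The fixed points of a complex functor and of its monad completion coincide: $\mathrm{Fix}(\mathcal{C}) = \mathrm{Fix}(\mathcal{C}^{\infty})$ for all $\mathcal{C}\in\mathbf{CF}$. (4) Altogether there is a commuting triangle of Galois connections between the complete lattices $\mathbf{CF}$, $\mathbf{CM}$ and $\mathbf{PV}^{\mathrm{op}}$: the surjective map $(-)^{\infty} : \mathbf{CF} \to \mathbf{CM}$ is lower adjoint to the inclusion $i: \mathbf{CM} \hookrightarrow \mathbf{CF}$; the map $\mathrm{Fix} : \mathbf{CF} \to \mathbf{PV}^{\mathrm{op}}$ is lower adjoint to $\mathrm{Max} : \mathbf{PV}^{\mathrm{op}} \to \mathbf{CF}$; the restriction $\mathrm{Fix} : \mathbf{CM} \to \mathbf{PV}^{\mathrm{op}}$ is lower adjoint to $\mathrm{Max} : \mathbf{PV}^{\mathrm{op}} \to \mathbf{CM}$ (in particular $\mathrm{Max}$ takes values in $\mathbf{CM}$); and these are compatible, in that the triangle of lower adjoints and the triangle of upper adjoints both commute.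
   Context: $\mathsf{FSgp}$ is the category of finite semigroups (the empty semigroup is allowed) and homomorphisms; its regular epimorphisms are the surjective homomorphisms. For a finite semigroup $S$, $\mathcal{P}(S)$ is the semigroup of non-empty subsets of $S$ under $XY = \{xy : x\in X, y\in Y\}$, and $\mathrm{sing}(S) \subseteq \mathcal{P}(S)$ is the subsemigroup of singletons. A homomorphism $\varphi : S \to T$ extends to $\dot\varphi : \mathcal{P}(S) \to \mathcal{P}(T)$, $X \mapsto \{\varphi(x) : x \in X\}$. For $\mathcal{X}\subseteq\mathcal{P}(S)$, $\downarrow\!\mathcal{X}$ is the set of $Y \in \mathcal{P}(S)$ with $Y \subseteq X$ for some $X \in \mathcal{X}$. An $S$-complex is a subsemigroup of $\mathcal{P}(S)$ which contains $\mathrm{sing}(S)$ and is closed under taking non-empty subsets of its members. A complex functor is a functor $\mathcal{C} : \mathsf{FSgp} \to \mathsf{FSgp}$ such that $\mathcal{C}(S)$ is an $S$-complex for every $S$, $\mathcal{C}(\varphi)$ is the restriction $\dot\varphi : \mathcal{C}(S) \to \mathcal{C}(T)$ for each $\varphi : S\to T$, and $\mathcal{C}$ preserves regular epimorphisms. $\mathbf{CF}$ is the collection of complex functors, ordered by $\mathcal{C}_1 \le \mathcal{C}_2$ iff $\mathcal{C}_1(S) \subseteq \mathcal{C}_2(S)$ for all $S$; it is a complete lattice whose joins are computed pointwise (in the complete lattice of $S$-complexes under inclusion). $\mathrm{Fix}(\mathcal{C}) = \{ S \in \mathsf{FSgp} : \mathcal{C}(S) = \mathrm{sing}(S) \}$;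 this is a pseudovariety. A complex monad is a complex functor $\mathcal{C}$ admitting a monad structure $(\mathcal{C}, \sigma, \mu)$ whose unit components are the singleton embeddings $S \to \mathcal{C}(S)$, $x \mapsto \{x\}$, and whose multiplication components are the union maps $\mathcal{C}(\mathcal{C}(S)) \to \mathcal{C}(S)$, $\mathcal{X} \mapsto \bigcup \mathcal{X}$. $\mathbf{CM}$ is the collection of complex monads. Monad completion: for $\mathcal{C} \in \mathbf{CF}$ define complex functors $\mathcal{C}^{[n]}$ recursively by $\mathcal{C}^{[0]}(S) = \mathrm{sing}(S)$ and $\mathcal{C}^{[n+1]}(S) = \downarrow\!\{ \bigcup \mathcal{A} : \mathcal{A} \in \mathcal{C}(\mathcal{C}^{[n]}(S)) \}$; these form an increasing sequence, and $\mathcal{C}^{\infty}(S) = \varinjlim_n \mathcal{C}^{[n]}(S) = \bigcup_n \mathcal{C}^{[n]}(S)$ for every finite semigroup $S$. A pseudovariety is a class of finite semigroups closed under subsemigroups, homomorphic images and finite products; $\mathbf{PV}$ is the complete lattice of pseudovarieties under inclusion. $\mathrm{Max}[\mathbf{V}] = \bigvee \{ \mathcal{C} \in \mathbf{CF} : \mathbf{V} \subseteq \mathrm{Fix}(\mathcal{C}) \}$. A Galois connection between posets is a pair of monotone maps $\delta : P_1 \to P_2$ (lower adjoint) and $\gamma : P_2 \to P_1$ (upper adjoint) with $\delta(x_1)\le x_2 \iff x_1 \le \gamma(x_2)$. *)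

(* Defs.v *)
From HB Require Import structures.
From mathcomp Require Import all_boot.
From mathcomp Require Import boolp.

Set Implicit Arguments.
Unset Strict Implicit.
Unset Printing Implicit Defensive.

Local Open Scope group_scope.

(* Finite semigroups; the carrier may be empty.  Homomorphisms are MathComp's *)
(* {multiplicative S -> T}.                                                   *)
#[short(type="finSemigroupType")]
HB.structure Definition FinSemigroup := {S of Semigroup S & Finite S}.
Bind Scope group_scope with FinSemigroup.sort.

Definition surjective (A B : Type) (f : A -> B) := forall y, exists x, f x = y.

Section OrderNotions.
Variables (T : Type) (le : T -> T -> Prop).

Definition partial_order :=
  [/\ forall x, le x x,
      forall x y z, le x y -> le y z -> le x z
    & forall x y, le x y -> le y x -> x = y].

Definition is_lub (A : T -> Prop) (x : T) :=
  (forall y, A y -> le y x) /\ (forall z, (forall y, A y -> le y z) -> le x z).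

Definition is_glb (A : T -> Prop) (x : T) :=
  (forall y, A y -> le x y) /\ (forall z, (forall y, A y -> le z y) -> le z x).

Definition complete_lattice :=
  partial_order /\
  (forall A : T -> Prop, (exists x, is_lub A x) /\ (exists x, is_glb A x)).

Definition closure_operator (cl : T -> T) :=
  [/\ forall x y, le x y -> le (cl x) (cl y),
      forall x, le x (cl x)
    & forall x, cl (cl x) = cl x].

End OrderNotions.

(* d is the lower adjoint, g the upper adjoint. *)
Definition galois_connection (T1 T2 : Type) (le1 : T1 -> T1 -> Prop)
    (le2 : T2 -> T2 -> Prop) (d : T1 -> T2) (g : T2 -> T1) :=
  [/\ forall x y, le1 x y -> le2 (d x) (d y),
      forall x y, le2 x y -> le1 (g x) (g y)
    & forall x y, le2 (d x) y <-> le1 x (g y)].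

Record functor := Functor {
  fobj :> finSemigroupType -> finSemigroupType;
  fmap : forall S T : finSemigroupType,
    {multiplicative S -> T} -> {multiplicative fobj S -> fobj T};
  fmap_id : forall S : finSemigroupType,
    fmap (idfun : {multiplicative S -> S}) =1 idfun;
  fmap_comp : forall (S T U : finSemigroupType)
      (g : {multiplicative T -> U}) (f : {multiplicative S -> T}),
    fmap (g \o f : {multiplicative S -> U}) =1 fmap g \o fmap f
}.

Record monad_structure (F : functor) := MonadStructure {
  munit : forall S : finSemigroupType, {multiplicative S -> F S};
  mmult : forall S : finSemigroupType, {multiplicative F (F S) -> F S};
  munit_natural : forall (S T : finSemigroupType) (f : {multiplicative S -> T}),
    munit T \o f =1 fmap F f \o munit S;
  mmult_natural : forall (S T : finSemigroupType) (f : {multiplicative S -> T}),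
    mmult T \o fmap F (fmap F f) =1 fmap F f \o mmult S;
  mmult_unitl : forall S : finSemigroupType, mmult S \o munit (F S) =1 idfun;
  mmult_unitr : forall S : finSemigroupType,
    mmult S \o fmap F (munit S) =1 idfun;
  mmult_assoc : forall S : finSemigroupType,
    mmult S \o mmult (F S) =1 mmult S \o fmap F (mmult S)
}.

Record subsemigroup (S : finSemigroupType) := Subsemigroup {
  ssg_set :> {set S};
  ssg_mul : mulg_closed ssg_set
}.

Section SubsemigroupType.
Variables (S : finSemigroupType) (A : subsemigroup S).

Definition ssg_type := {x : S | x \in (A : {set S})}.
HB.instance Definition _ := Finite.on ssg_type.
HB.instance Definition _ := SubType.on ssg_type.

Definition ssg_op (x y : ssg_type) : ssg_type :=
  Sub (val x * val y) (ssg_mul (valP x) (valP y)).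

Lemma ssg_opA : associative ssg_op.
Proof. by move=> x y z; apply: val_inj; rewrite /= mulgA. Qed.

HB.instance Definition _ := isSemigroup.Build ssg_type ssg_opA.

End SubsemigroupType.

Coercion ssg_type : subsemigroup >-> Sortclass.

Section Product.
Variables (n : nat) (S : 'I_n -> finSemigroupType).

Definition prod_sgp : Type := {dffun forall i : 'I_n, S i}.
HB.instance Definition _ := Finite.on prod_sgp.

Definition prod_op (f g : prod_sgp) : prod_sgp := [ffun i => f i * g i].

Lemma prod_opA : associative prod_op.
Proof. by move=> f g h; apply/ffunP => i; rewrite !ffunE mulgA. Qed.

HB.instance Definition _ := isSemigroup.Build prod_sgp prod_opA.

Definition prod_proj (i : 'I_n) (f : prod_sgp) : S i := f i.

Lemma prod_projM i : {morph prod_proj i : f g / f * g}.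
Proof. by move=> f g; rewrite /prod_proj [in LHS]ffunE. Qed.

HB.instance Definition _ i :=
  isMultiplicative.Build prod_sgp (S i) (prod_proj i) (prod_projM i).

End Product.

Section Power.
Variable S : finSemigroupType.

Record pow := Pow {pow_set :> {set S}; pow_neq0 : pow_set != set0}.
HB.instance Definition _ := [isSub for pow_set].
HB.instance Definition _ := [Finite of pow by <:].

Lemma pow_mul_neq0 (X Y : pow) :
  [set x * y | x in (X : {set S}), y in (Y : {set S})] != set0.
Proof.
have /set0Pn[x Xx] := pow_neq0 X; have /set0Pn[y Yy] := pow_neq0 Y.
by apply/set0Pn; exists (x * y); apply/imset2P; exists x y.
Qed.

Definition pow_mul (X Y : pow) : pow := Pow (pow_mul_neq0 X Y).

Lemma pow_mulA : associative pow_mul.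
Proof.
move=> X Y Z; apply: val_inj; apply/setP => u /=.
apply/imset2P/imset2P => [[x _ Xx /imset2P[y z Yy Zz ->] ->]|].
  by exists (x * y) z => //; [apply/imset2P; exists x y | rewrite mulgA].
case=> _ z /imset2P[x y Xx Yy ->] Zz ->.
by exists x (y * z) => //; [apply/imset2P; exists y z | rewrite mulgA].
Qed.

HB.instance Definition _ := isSemigroup.Build pow pow_mulA.

Lemma pow1_neq0 (x : S) : [set x] != set0.
Proof. by apply/set0Pn; exists x; rewrite inE. Qed.

Definition pow1 (x : S) : pow := Pow (pow1_neq0 x).

Lemma pow1M : {morph pow1 : x y / x * y}.
Proof.
move=> x y; apply: val_inj; apply/setP => z /=; rewrite inE.
apply/eqP/imset2P => [->|[_ _ /set1P-> /set1P-> //]].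
by exists x y; rewrite ?inE.
Qed.

Definition sing : {set pow} := [set pow1 x | x : S].

Definition down (A : {set pow}) : {set pow} :=
  [set Y : pow | [exists X in A, (Y : {set S}) \subset (X : {set S})]].

Record is_complex (A : {set pow}) : Prop := IsComplex {
  complex_mul : mulg_closed A;
  complex_sing : sing \subset A;
  complex_down : forall X Y : pow,
    X \in A -> (Y : {set S}) \subset (X : {set S}) -> Y \in A
}.

Record complex := Complex {
  cx_set : {set pow};
  cxP : is_complex cx_set
}.

Definition cx_subsemigroup (A : complex) : subsemigroup pow :=
  Subsemigroup (complex_mul (cxP A)).

Lemma complex_inj (A B : complex) : cx_set A = cx_set B -> A = B.
Proof.
case: A B => [A Ap] [B Bp] /= eqAB; case: B / eqAB Bp => Bp.
by rewrite (Prop_irrelevance Ap Bp).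
Qed.

Lemma sing_complex_subproof : is_complex sing.
Proof.
split=> // [_ _ /imsetP[x _ ->] /imsetP[y _ ->]|_ Y /imsetP[x _ ->] /=].
  by rewrite -pow1M imset_f.
rewrite subset1 (negPf (pow_neq0 Y)) orbF => /eqP Yx.
by apply/imsetP; exists x => //; apply: val_inj.
Qed.

Definition sing_complex : complex := Complex sing_complex_subproof.

End Power.

Coercion cx_subsemigroup : complex >-> subsemigroup.

Section PowerMap.
Variables (S T : finSemigroupType) (f : {multiplicative S -> T}).

Lemma pow_map_neq0 (X : pow S) : f @: (X : {set S}) != set0.
Proof. by rewrite imset_eq0 pow_neq0. Qed.

Definition pow_map (X : pow S) : pow T := Pow (pow_map_neq0 X).

Lemma pow_mapM : {morph pow_map : X Y / X * Y}.
Proof.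
move=> X Y; apply: val_inj; apply/setP => z /=.
apply/imsetP/imset2P => [[_ /imset2P[x y Xx Yy ->] ->]|].
  by exists (f x) (f y); rewrite ?imset_f // gmulfM.
case=> _ _ /imsetP[x Xx ->] /imsetP[y Yy ->] ->.
by exists (x * y); [apply/imset2P; exists x y | rewrite gmulfM].
Qed.

HB.instance Definition _ :=
  isMultiplicative.Build (pow S) (pow T) pow_map pow_mapM.

Lemma pow_map1 x : pow_map (pow1 x) = pow1 (f x).
Proof. by apply: val_inj; rewrite /= imset_set1. Qed.

Definition restricts (A : complex S) (B : complex T) :=
  forall X : pow S, X \in cx_set A -> pow_map X \in cx_set B.

Section Restriction.
Variables (A : complex S) (B : complex T) (fAB : restricts A B).

Definition cx_map (X : A) : B := Sub (pow_map (val X)) (fAB (valP X)).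

Lemma cx_mapM : {morph cx_map : X Y / X * Y}.
Proof. by move=> X Y; apply: val_inj; rewrite /= pow_mapM. Qed.

HB.instance Definition _ := isMultiplicative.Build A B cx_map cx_mapM.

End Restriction.

End PowerMap.

(* On morphisms a complex functor is the restriction of pow_map, so only its  *)
(* values on objects are data; cf_functor below is the resulting functor.     *)
Record complex_functor := ComplexFunctor {
  cf_obj :> forall S : finSemigroupType, complex S;
  cf_restricts : forall (S T : finSemigroupType) (f : {multiplicative S -> T}),
    restricts f (cf_obj S) (cf_obj T);
  cf_surj : forall (S T : finSemigroupType) (f : {multiplicative S -> T}),
    surjective f -> surjective (cx_map (cf_restricts f))
}.

Arguments cf_restricts c {S T} f [X].
Arguments cf_surj c {S T} f.

Section UnderlyingFunctor.
Variable C : complex_functor.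

Definition cf_map (S T : finSemigroupType) (f : {multiplicative S -> T}) :
  {multiplicative C S -> C T} := cx_map (cf_restricts C f).

Lemma cf_map_id (S : finSemigroupType) :
  cf_map (idfun : {multiplicative S -> S}) =1 idfun.
Proof. by move=> X; do 2!apply: val_inj; rewrite /= imset_id. Qed.

Lemma cf_map_comp (S T U : finSemigroupType)
    (g : {multiplicative T -> U}) (f : {multiplicative S -> T}) :
  cf_map (g \o f : {multiplicative S -> U}) =1 cf_map g \o cf_map f.
Proof. by move=> X; do 2!apply: val_inj; rewrite /= imset_comp. Qed.

Definition cf_functor : functor := Functor cf_map_id cf_map_comp.

End UnderlyingFunctor.

(* The union of a non-empty set of members of an S-complex. *)
Section Union.
Variables (S : finSemigroupType) (A : complex S).

Lemma cx_union_neq0 (XX : pow A) :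
  \bigcup_(X in (XX : {set A})) (val X : {set S}) != set0.
Proof.
have /set0Pn[X XXX] := pow_neq0 XX; have /set0Pn[x Xx] := pow_neq0 (val X).
by apply/set0Pn; exists x; apply/bigcupP; exists X.
Qed.

Definition cx_union (XX : pow A) : pow S := Pow (cx_union_neq0 XX).

Lemma mem_cx_union (XX : pow A) (x : S) :
  reflect (exists2 X : A, X \in (XX : {set A}) & x \in (val X : {set S}))
          (x \in (cx_union XX : {set S})).
Proof. exact: bigcupP. Qed.

Lemma cx_unionM : {morph cx_union : XX YY / XX * YY}.
Proof.
move=> XX YY; apply: val_inj; apply/setP => z /=.
apply/bigcupP/imset2P => [[_ /imset2P[X Y XXX YYY ->]] /imset2P[x y Xx Yy ->]|].
  by exists x y => //; apply/bigcupP; [exists X | exists Y].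
case=> x y /bigcupP[X XXX Xx] /bigcupP[Y YYY Yy] ->.
exists (X * Y); first by apply/imset2P; exists X Y.
by apply/imset2P; exists x y.
Qed.

End Union.

Definition is_complex_monad (C : complex_functor) : Prop :=
  exists M : monad_structure (cf_functor C),
    (forall (S : finSemigroupType) (x : S), val (munit M S x) = pow1 x) /\
    (forall (S : finSemigroupType) (XX : C (C S)),
       val (mmult M S XX) = cx_union (val XX)).

Record complex_monad := ComplexMonad {
  cm_functor :> complex_functor;
  cmP : is_complex_monad cm_functor
}.

Definition cf_le (C D : complex_functor) : Prop :=
  forall S : finSemigroupType, cx_set (C S) \subset cx_set (D S).

Definition cm_le (C D : complex_monad) : Prop := cf_le C D.

Definition cm_image (P : complex_monad -> Prop) (C : complex_functor) : Prop :=
  exists2 M : complex_monad, P M & cm_functor M = C.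

Lemma preim_is_complex (S T : finSemigroupType) (f : {multiplicative S -> T})
    (B : complex T) :
  is_complex [set X : pow S | pow_map f X \in cx_set B].
Proof.
have [BM B1 Bd] := cxP B.
split=> [X Y|| X Y]; rewrite ?inE.
- by move=> BX BY; rewrite pow_mapM BM.
- apply/subsetP => _ /imsetP[x _ ->]; rewrite inE pow_map1.
  by apply: (subsetP B1); rewrite imset_f.
- by move=> BX sYX; apply: Bd BX _; apply: imsetS.
Qed.

Definition preim_complex (S T : finSemigroupType)
    (f : {multiplicative S -> T}) (B : complex T) :=
  Complex (preim_is_complex f B).

Lemma pow_map_lift (S T : finSemigroupType) (f : {multiplicative S -> T})
    (X : pow S) (Y : pow T) :
  (Y : {set T}) \subset (pow_map f X : {set T}) ->
  exists2 Z : pow S, (Z : {set S}) \subset (X : {set S}) & pow_map f Z = Y.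
Proof.
move=> sYX; have fZ : f @: ((X : {set S}) :&: f @^-1: (Y : {set T})) = Y.
  apply/setP => y; apply/imsetP/idP => [[x /setIP[_]]|Yy].
    by rewrite inE => ? ->.
  have /imsetP[x Xx eqy] := subsetP sYX _ Yy.
  by exists x => //; rewrite inE Xx inE -eqy.
have Z0 : (X : {set S}) :&: f @^-1: (Y : {set T}) != set0.
  by rewrite -(imset_eq0 f) fZ pow_neq0.
by exists (Pow Z0); [apply: subsetIl | apply: val_inj].
Qed.

Lemma im_is_complex (S T : finSemigroupType) (f : {multiplicative S -> T})
    (A : complex S) : surjective f ->
  is_complex [set pow_map f X | X in cx_set A].
Proof.
move=> fsurj; have [AM A1 Ad] := cxP A.
split=> [_ _ /imsetP[X AX ->] /imsetP[Y AY ->]||].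
- by rewrite -pow_mapM imset_f ?AM.
- apply/subsetP => _ /imsetP[y _ ->]; have [x <-] := fsurj y.
  by rewrite -pow_map1 imset_f // (subsetP A1) ?imset_f.
- move=> _ Y /imsetP[X AX ->] /pow_map_lift[Z sZX <-].
  by rewrite imset_f // (Ad X).
Qed.

Definition im_complex (S T : finSemigroupType)
    (f : {multiplicative S -> T}) (A : complex S) (fsurj : surjective f) :=
  Complex (im_is_complex A fsurj).

Lemma cf_lift (C : complex_functor) (S T : finSemigroupType)
    (f : {multiplicative S -> T}) (Y : pow T) :
  surjective f -> Y \in cx_set (C T) ->
  exists2 X : pow S, X \in cx_set (C S) & pow_map f X = Y.
Proof.
move=> fsurj CY; have [X eqX] := cf_surj C f fsurj (Sub Y CY).
by exists (val X); [exact: valP | move/(congr1 val): eqX].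
Qed.

Lemma surj_cx_map (S T : finSemigroupType) (f : {multiplicative S -> T})
    (A : complex S) (B : complex T) (fAB : restricts f A B) :
  (forall Y, Y \in cx_set B -> exists2 X, X \in cx_set A & pow_map f X = Y) ->
  surjective (cx_map fAB).
Proof.
move=> lift Y; have [X AX fX] := lift _ (valP Y).
by exists (Sub X AX); apply: val_inj.
Qed.

Section SingFunctor.

Lemma sing_restricts (S T : finSemigroupType) (f : {multiplicative S -> T}) :
  restricts f (sing_complex S) (sing_complex T).
Proof. by move=> _ /imsetP[x _ ->]; rewrite pow_map1 imset_f. Qed.

Lemma sing_surj (S T : finSemigroupType) (f : {multiplicative S -> T}) :
  surjective f -> surjective (cx_map (sing_restricts f)).
Proof.
move=> fsurj; apply: surj_cx_map => _ /imsetP[y _ ->].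
have [x <-] := fsurj y.
by exists (pow1 x); [rewrite imset_f | rewrite pow_map1].
Qed.

Definition sing_functor : complex_functor := ComplexFunctor sing_surj.

End SingFunctor.

(* Joins in the lattice of complex functors, computed pointwise: the value at *)
(* S is the least S-complex containing all the C S.                           *)
Section Join.
Variable P : complex_functor -> Prop.

Definition join_ub (S : finSemigroupType) (A : complex S) : Prop :=
  forall C, P C -> cx_set (C S) \subset cx_set A.

Definition join_set (S : finSemigroupType) : {set pow S} :=
  [set X | `[< forall A : complex S, join_ub A -> X \in cx_set A >]].

Lemma join_setP (S : finSemigroupType) (X : pow S) :
  X \in join_set S <-> forall A : complex S, join_ub A -> X \in cx_set A.
Proof. by rewrite inE; split=> [/asboolP|H]; last apply/asboolP. Qed.

Lemma join_is_complex (S : finSemigroupType) : is_complex (join_set S).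
Proof.
split=> [X Y /join_setP HX /join_setP HY||X Y /join_setP HX sYX].
- apply/join_setP => A ubA.
  by apply: (complex_mul (cxP A)); [apply: HX | apply: HY].
- apply/subsetP => X sX; apply/join_setP => A _.
  exact: (subsetP (complex_sing (cxP A))).
- apply/join_setP => A ubA.
  by apply: (complex_down (cxP A)) sYX; apply: HX.
Qed.

Definition join_complex (S : finSemigroupType) : complex S :=
  Complex (join_is_complex S).

Lemma join_restricts (S T : finSemigroupType) (f : {multiplicative S -> T}) :
  restricts f (join_complex S) (join_complex T).
Proof.
move=> X /join_setP HX; apply/join_setP => B ubB.
suff: X \in cx_set (preim_complex f B) by rewrite inE.
apply: HX => C PC; apply/subsetP => Y CY; rewrite inE.
exact/(subsetP (ubB _ PC))/cf_restricts.
Qed.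

Lemma join_surj (S T : finSemigroupType) (f : {multiplicative S -> T}) :
  surjective f -> surjective (cx_map (join_restricts f)).
Proof.
move=> fsurj; apply: surj_cx_map => Y /join_setP HY.
suff: Y \in cx_set (im_complex (join_complex S) fsurj).
  by move=> /imsetP[X JX ->]; exists X.
apply: HY => C PC; apply/subsetP => Z CZ.
have [X CX <-] := cf_lift fsurj CZ; rewrite imset_f //.
by apply/join_setP => A ubA; apply: (subsetP (ubA _ PC)).
Qed.

Definition cf_join : complex_functor := ComplexFunctor join_surj.

Lemma cf_joinP : is_lub cf_le P cf_join.
Proof.
split=> [C PC S|D ubD S]; apply/subsetP => X.
  by move=> CX; apply/join_setP => A ubA; apply: (subsetP (ubA _ PC)).
by move=> /join_setP; apply=> C PC; apply: ubD.
Qed.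

End Join.

(* One step of the monad completion: S |-> down { U A : A in C (D S) }. *)
Section Step.
Variables C D : complex_functor.

Definition step_set (S : finSemigroupType) : {set pow S} :=
  down [set cx_union A | A in cx_set (C (D S))].

Lemma step_setP (S : finSemigroupType) (Y : pow S) :
  reflect (exists2 A : pow (D S), A \in cx_set (C (D S)) &
             (Y : {set S}) \subset (cx_union A : {set S}))
          (Y \in step_set S).
Proof.
rewrite inE; apply: (iffP exists_inP) => [[_ /imsetP[A CA ->] sY]|[A CA sY]].
  by exists A.
by exists (cx_union A); rewrite ?imset_f.
Qed.

Lemma cx_union1 (S : finSemigroupType) (A : complex S) (X : A) :
  cx_union (pow1 X) = val X.
Proof. by apply: val_inj; rewrite /= big_set1. Qed.

Lemma cf_sub_step (S : finSemigroupType) :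
  cx_set (D S) \subset step_set S.
Proof.
apply/subsetP => X DX; apply/step_setP; exists (pow1 (Sub X DX : D S)).
  by apply: (subsetP (complex_sing (cxP _))); rewrite imset_f.
by rewrite cx_union1.
Qed.

Lemma step_is_complex (S : finSemigroupType) : is_complex (step_set S).
Proof.
split=> [X Y /step_setP[A CA sX] /step_setP[B CB sY]||X Y].
- apply/step_setP; exists (A * B).
    exact: (complex_mul (cxP _)).
  by rewrite cx_unionM; apply: imset2S.
- exact: subset_trans (complex_sing (cxP (D S))) (cf_sub_step S).
- move=> /step_setP[A CA sX] sYX; apply/step_setP; exists A => //.
  exact: subset_trans sYX sX.
Qed.

Definition step_complex (S : finSemigroupType) : complex S :=
  Complex (step_is_complex S).

Lemma cx_union_map (S T : finSemigroupType) (f : {multiplicative S -> T})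
    (A : complex S) (B : complex T) (fAB : restricts f A B) (XX : pow A) :
  cx_union (pow_map (cx_map fAB) XX) = pow_map f (cx_union XX).
Proof.
apply: val_inj; apply/setP => y /=.
apply/bigcupP/imsetP => [[_ /imsetP[X XXX ->] /imsetP[x Xx ->]]|].
  by exists x => //; apply/bigcupP; exists X.
case=> x /bigcupP[X XXX Xx] ->.
by exists (cx_map fAB X); rewrite imset_f.
Qed.

Lemma step_restricts (S T : finSemigroupType) (f : {multiplicative S -> T}) :
  restricts f (step_complex S) (step_complex T).
Proof.
move=> X /step_setP[A CA sX]; apply/step_setP.
exists (pow_map (cf_map D f) A); first exact: cf_restricts.
by rewrite cx_union_map; apply: imsetS.
Qed.

Lemma step_surj (S T : finSemigroupType) (f : {multiplicative S -> T}) :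
  surjective f -> surjective (cx_map (step_restricts f)).
Proof.
move=> fsurj; apply: surj_cx_map => Y /step_setP[B CB sY].
have [A CA eqB] := @cf_lift C _ _ (cf_map D f) _ (cf_surj D f fsurj) CB.
rewrite -eqB cx_union_map in sY.
have [Z sZ <-] := pow_map_lift sY.
by exists Z => //; apply/step_setP; exists A.
Qed.

Definition step : complex_functor := ComplexFunctor step_surj.

End Step.

(* iterate n is C^[n]; the completion is their pointwise union.               *)
Section Completion.
Variable C : complex_functor.

Fixpoint iterate (n : nat) : complex_functor :=
  if n is m.+1 then step C (iterate m) else sing_functor.

Lemma iterate_le m n (S : finSemigroupType) : m <= n ->
  cx_set (iterate m S) \subset cx_set (iterate n S).
Proof.
move/subnKC <-; elim: {n}(n - m)%N => [|k IHk]; rewrite ?addn0 // addnS.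
exact: subset_trans IHk (cf_sub_step C _ S).
Qed.

Definition completion_set (S : finSemigroupType) : {set pow S} :=
  [set X | `[< exists n, X \in cx_set (iterate n S) >]].

Lemma completion_setP (S : finSemigroupType) (X : pow S) :
  reflect (exists n, X \in cx_set (iterate n S)) (X \in completion_set S).
Proof. by rewrite inE; apply: asboolP. Qed.

Lemma completion_is_complex (S : finSemigroupType) :
  is_complex (completion_set S).
Proof.
split=> [X Y /completion_setP[m mX] /completion_setP[n nY]||X Y].
- apply/completion_setP; exists (maxn m n); apply: (complex_mul (cxP _)).
    by apply: (subsetP (iterate_le S _)) mX; apply: leq_maxl.
  by apply: (subsetP (iterate_le S _)) nY; apply: leq_maxr.
- by apply/subsetP => X sX; apply/completion_setP; exists 0%N.
- move=> /completion_setP[n nX] sYX; apply/completion_setP; exists n.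
  exact: (complex_down (cxP _)) sYX.
Qed.

Definition completion_complex (S : finSemigroupType) : complex S :=
  Complex (completion_is_complex S).

Lemma completion_restricts (S T : finSemigroupType)
    (f : {multiplicative S -> T}) :
  restricts f (completion_complex S) (completion_complex T).
Proof.
move=> X /completion_setP[n nX]; apply/completion_setP; exists n.
exact: cf_restricts.
Qed.

Lemma completion_surj (S T : finSemigroupType) (f : {multiplicative S -> T}) :
  surjective f -> surjective (cx_map (completion_restricts f)).
Proof.
move=> fsurj; apply: surj_cx_map => Y /completion_setP[n nY].
have [X nX <-] := cf_lift fsurj nY.
by exists X => //; apply/completion_setP; exists n.
Qed.

Definition completion : complex_functor := ComplexFunctor completion_surj.

End Completion.

(* The product clause with n = 0 puts the trivial semigroup in every          *)
(* pseudovariety.                                                             *)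
Record is_pseudovariety (V : finSemigroupType -> Prop) : Prop :=
  IsPseudovariety {
    pv_sub : forall (S : finSemigroupType) (A : subsemigroup S), V S -> V A;
    pv_im : forall (S T : finSemigroupType) (f : {multiplicative S -> T}),
      surjective f -> V S -> V T;
    pv_prod : forall (n : nat) (S : 'I_n -> finSemigroupType),
      (forall i, V (S i)) -> V (prod_sgp S)
  }.

Record pseudovariety := Pseudovariety {
  pv_class :> finSemigroupType -> Prop;
  pvP : is_pseudovariety pv_class
}.

Definition pv_le (V W : pseudovariety) : Prop := forall S, V S -> W S.

Definition pv_op_le (V W : pseudovariety) : Prop := pv_le W V.

Section Fix.
Variable C : complex_functor.

Definition fix_class (S : finSemigroupType) : Prop := cx_set (C S) = sing S.

Lemma fix_classP (S : finSemigroupType) :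
  fix_class S <-> forall X, X \in cx_set (C S) -> X \in sing S.
Proof.
split=> [-> //|H]; apply/eqP; rewrite eqEsubset (complex_sing (cxP _)) andbT.
exact/subsetP.
Qed.

Lemma singP (S : finSemigroupType) (X : pow S) :
  {in (X : {set S}) &, forall x y, x = y} -> X \in sing S.
Proof.
move=> eqX; have /set0Pn[x Xx] := pow_neq0 X.
apply/imsetP; exists x => //; apply: val_inj; apply/setP => y /=; rewrite inE.
by apply/idP/eqP => [Xy|-> //]; apply: eqX.
Qed.

Lemma mem_sing (S : finSemigroupType) (X : pow S) : X \in sing S ->
  {in (X : {set S}) &, forall x y, x = y}.
Proof. by move=> /imsetP[z _ ->] x y /set1P-> /set1P->. Qed.

Lemma fix_is_pseudovariety : is_pseudovariety fix_class.
Proof.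
split=> [S A|S T f fsurj|n S] /= H; apply/fix_classP => X CX.
- pose f := val : A -> S.
  have fM : {morph f : x y / x * y} by [].
  pose fH : {multiplicative A -> S} :=
    HB.pack f (isMultiplicative.Build _ _ f fM).
  have/fix_classP/(_ _ (cf_restricts C fH CX))/mem_sing XS := H.
  apply: singP => x y Xx Xy; apply: val_inj.
  by apply: XS; apply: (imset_f f).
- have [Y CY <-] := cf_lift fsurj CX.
  have/fix_classP/(_ _ CY)/imsetP[x _ ->] := H.
  by rewrite pow_map1 imset_f.
- apply: singP => x y Xx Xy; apply/ffunP => i.
  pose f := prod_proj (S := S) i.
  have/fix_classP/(_ _ (cf_restricts C f CX))/mem_sing XS := H i.
  by apply: (XS (f x) (f y)); apply: (imset_f f).
Qed.

Definition Fix : pseudovariety := Pseudovariety fix_is_pseudovariety.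

End Fix.

Definition Max (V : pseudovariety) : complex_functor :=
  cf_join (fun C => pv_le V (Fix C)).

(* Main.v *)
Require Import Defs.
From mathcomp Require Import all_boot.
From HB Require Import structures.
From mathcomp Require Import boolp.

(** Call a complex functor union-closed when the union of every member of
    [D (D S)] belongs to [D S].  The functor and monad laws hold for singletons
    and unions of arbitrary sets, so the union-closed complex functors are
    exactly the complex monads ([union_closedP]).

    The completion of [C] is union-closed because [S] is finite: the chain of
    the [iterate C n S] is stationary, so the completion [D] satisfies
    [step C D] below [D] ([completion_step]), and from this an induction on [m]
    gives that unions of members of [iterate C m (D S)] stay in [D S]
    ([iterate_union]).  It is moreover the least union-closed complex functor
    above [C] ([completion_least]).  That the completion is a closure operator
    with image the complex monads, the descriptions of meets and joins of
    complex monads and the adjunction with the inclusion are formal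
    consequences of these two facts.

    If [C S] consists of singletons, so does every [iterate C n S], by induction
    on [n]: this complex is then a copy of [S], hence is itself fixed by [C]
    ([Fix_completion]).  On the side of pseudovarieties, joins are computed
    inside the complexes of [S] and [sing S] is such a complex, so [V] is
    contained in [Fix (Max V)]; this is the adjunction of [Fix] and [Max]
    ([Fix_Max_adjoint]).  Finally [completion (Max V)] has the same fixed points
    as [Max V], so it lies below [Max V] by the adjunction, and [Max V] is a
    complex monad. *)

Set Implicit Arguments.
Unset Strict Implicit.
Unset Printing Implicit Defensive.

Local Open Scope group_scope.

(** * Order theory *)

(** A greatest lower bound is a least upper bound of the lower bounds. *)
Lemma lubs_complete_lattice (T : Type) (le : T -> T -> Prop) :
  partial_order le -> (forall A : T -> Prop, exists x, is_lub le A x) ->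
  complete_lattice le.
Proof.
move=> le_po lubs; split=> // A; split; first exact: lubs.
have [x [ub_x least_x]] := lubs (fun z => forall y, A y -> le z y).
exists x; split=> [y Ay|z lb_z]; last exact: ub_x.
by apply: least_x => z; apply.
Qed.

Lemma lub_unique (T : Type) (le : T -> T -> Prop) (A : T -> Prop) (x y : T) :
  partial_order le -> is_lub le A x -> is_lub le A y -> x = y.
Proof.
move=> [_ _ anti] [ub_x least_x] [ub_y least_y].
by apply: anti; [apply: least_x | apply: least_y].
Qed.

(** * Extensionality and the three orders *)

Lemma cf_le_refl C : cf_le C C.
Proof. by move=> S. Qed.

Lemma cf_le_trans D C E : cf_le C D -> cf_le D E -> cf_le C E.
Proof. by move=> leCD leDE S; apply: subset_trans (leCD S) (leDE S). Qed.

Lemma cf_le_anti C D : cf_le C D -> cf_le D C -> C = D.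
Proof.
move=> leCD leDC; have: cf_obj C = cf_obj D.
  apply: functional_extensionality_dep => S; apply: complex_inj.
  by apply/eqP; rewrite eqEsubset leCD leDC.
case: C D {leCD leDC} => [C Cr Cs] [D Dr Ds] /= eqCD.
case: D / eqCD Dr Ds => Dr Ds.
case: Dr / (Prop_irrelevance Cr Dr) Ds => Ds.
by rewrite (Prop_irrelevance Cs Ds).
Qed.

Lemma cf_le_order : partial_order cf_le.
Proof.
split; [exact: cf_le_refl | | exact: cf_le_anti].
by move=> C D E; apply: cf_le_trans.
Qed.

Lemma cm_functor_inj (M N : complex_monad) :
  cm_functor M = cm_functor N -> M = N.
Proof.
case: M N => [C Cm] [D Dm] /= eqCD; case: D / eqCD Dm => Dm.
by rewrite (Prop_irrelevance Cm Dm).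
Qed.

Lemma cm_le_order : partial_order cm_le.
Proof.
split=> [M|M N K|M N leMN leNM]; first exact: cf_le_refl.
- exact: cf_le_trans.
- exact/cm_functor_inj/cf_le_anti.
Qed.

Lemma pv_ext (V W : pseudovariety) : (forall S, V S <-> W S) -> V = W.
Proof.
move=> eqVW; have: pv_class V = pv_class W.
  by apply: funext => S; apply/propext/eqVW.
case: V W {eqVW} => [V Vp] [W Wp] /= eqVW; case: W / eqVW Wp => Wp.
by rewrite (Prop_irrelevance Vp Wp).
Qed.

Lemma pv_op_le_order : partial_order pv_op_le.
Proof.
split=> [V S //|V W U leVW leWU S US|V W leWV leVW].
  by apply/leVW/leWU.
by apply: pv_ext => S; split; [apply: leVW | apply: leWV].
Qed.

Lemma pv_meet_is_pseudovariety (P : pseudovariety -> Prop) :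
  is_pseudovariety (fun S => forall V, P V -> pv_class V S).
Proof.
split=> [S A VS V PV|S T f fsurj VS V PV|n S VS V PV].
- exact: (pv_sub (pvP V)) (VS V PV).
- exact: (pv_im (pvP V)) fsurj (VS V PV).
- by apply: (pv_prod (pvP V)) => i; apply: VS.
Qed.

Lemma cf_complete_lattice : complete_lattice cf_le.
Proof.
apply: lubs_complete_lattice; first exact: cf_le_order.
by move=> P; exists (cf_join P); apply: cf_joinP.
Qed.

(** In the reversed order, least upper bounds are intersections. *)
Lemma pv_op_complete_lattice : complete_lattice pv_op_le.
Proof.
apply: lubs_complete_lattice; first exact: pv_op_le_order.
move=> P; exists (Pseudovariety (pv_meet_is_pseudovariety P)).
split=> [V PV S|W ubW S WS V PV]; first by apply.
exact: ubW.
Qed.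

(** * Homomorphisms into complexes *)

Lemma mem_sing_cx (S : finSemigroupType) (A : complex S) (x : S) :
  pow1 x \in cx_set A.
Proof. by apply: (subsetP (complex_sing (cxP A))); rewrite imset_f. Qed.

Section UnitMap.
Variables (S : finSemigroupType) (A : complex S).

Definition unit_map (x : S) : A := Sub (pow1 x) (mem_sing_cx A x).

Lemma unit_mapM : {morph unit_map : x y / x * y}.
Proof. by move=> x y; apply: val_inj; rewrite /= pow1M. Qed.

HB.instance Definition _ := isMultiplicative.Build S A unit_map unit_mapM.

End UnitMap.

Section InclusionMap.
Variables (S : finSemigroupType) (A B : complex S).
Hypothesis sAB : cx_set A \subset cx_set B.

Definition incl_map (X : A) : B := Sub (val X) (subsetP sAB _ (valP X)).

Lemma incl_mapM : {morph incl_map : X Y / X * Y}.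
Proof. by move=> X Y; apply: val_inj. Qed.

HB.instance Definition _ := isMultiplicative.Build A B incl_map incl_mapM.

End InclusionMap.

Section UnionMap.
Variables (S : finSemigroupType) (A E : complex S) (B : complex A).
Hypothesis unionE : forall XX, XX \in cx_set B -> cx_union XX \in cx_set E.

Definition union_map (XX : B) : E := Sub (cx_union (val XX)) (unionE (valP XX)).

Lemma union_mapM : {morph union_map : XX YY / XX * YY}.
Proof. by move=> XX YY; apply: val_inj; rewrite /= -cx_unionM. Qed.

HB.instance Definition _ := isMultiplicative.Build B E union_map union_mapM.

(** Both sides are the set of elements of elements of elements of [XXX]; this
    is the associativity of union. *)
Lemma cx_union_union (XXX : pow B) :
  cx_union (pow_map union_map XXX) = cx_union (cx_union XXX).
Proof.
apply: val_inj; apply/setP => x; apply/mem_cx_union/mem_cx_union.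
  move=> [_ /imsetP[XX XXin ->] /mem_cx_union[X Xin Xx]].
  by exists X => //; apply/mem_cx_union; exists XX.
move=> [X /mem_cx_union[XX XXin Xin] Xx].
exists (union_map XX); first exact: imset_f.
by apply/mem_cx_union; exists X.
Qed.

End UnionMap.

Lemma cx_union_unit (S : finSemigroupType) (A : complex S) (X : pow S) :
  cx_union (pow_map (unit_map A) X) = X.
Proof.
apply: val_inj; apply/setP => x; apply/mem_cx_union/idP.
  by move=> [_ /imsetP[y Xy ->] /set1P->].
by move=> Xx; exists (unit_map A x); [apply: imset_f | apply/set1P].
Qed.

Lemma cx_union_incl (S : finSemigroupType) (A B : complex S)
    (sAB : cx_set A \subset cx_set B) (XX : pow A) :
  cx_union (pow_map (incl_map sAB) XX) = cx_union XX.
Proof.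
apply: val_inj; apply/setP => x; apply/mem_cx_union/mem_cx_union.
  by move=> [_ /imsetP[X XXX ->] Xx]; exists X.
by move=> [X XXX Xx]; exists (incl_map sAB X) => //; apply: imset_f.
Qed.

Lemma cx_union_sub (S : finSemigroupType) (A : complex S) (XX YY : pow A) :
  (XX : {set A}) \subset YY ->
  (cx_union XX : {set S}) \subset cx_union YY.
Proof.
move=> sXY; apply/subsetP => x /mem_cx_union[X XXX Xx].
by apply/mem_cx_union; exists X; rewrite ?(subsetP sXY).
Qed.

(** * Complex monads as union-closed complex functors *)

Definition union_closed (D : complex_functor) : Prop :=
  forall (S : finSemigroupType) (XX : pow (D S)),
    XX \in cx_set (D (D S)) -> cx_union XX \in cx_set (D S).

Section UnionMonad.
Variables (D : complex_functor) (Dcl : union_closed D).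

Definition union_monad : monad_structure (cf_functor D).
Proof.
exists (fun S : finSemigroupType => unit_map (D S) : {multiplicative S -> D S})
       (fun S : finSemigroupType =>
          union_map (Dcl (S := S)) : {multiplicative D (D S) -> D S}).
- by move=> S T f x; apply: val_inj; rewrite /= pow_map1.
- by move=> S T f XX; apply: val_inj; rewrite /= cx_union_map.
- by move=> S X; apply: val_inj; rewrite /= cx_union1.
- by move=> S X; apply: val_inj; rewrite /= cx_union_unit.
- by move=> S XXX; apply: val_inj; rewrite /= cx_union_union.
Defined.

End UnionMonad.

Lemma union_closedP (D : complex_functor) :
  is_complex_monad D <-> union_closed D.
Proof.
split=> [[M [_ multE]] S XX DXX|Dcl]; last by exists (union_monad Dcl).
have := valP (mmult M S (Sub XX DXX : D (D S))).
by rewrite multE.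
Qed.

(** * The completion is the least complex monad above a complex functor *)

(** As [pow S] is finite, the values at [S] of the increasing sequence of
    iterates become constant. *)
Lemma iterate_stationary (C : complex_functor) (S : finSemigroupType) :
  exists n, cx_set (completion C S) \subset cx_set (iterate C n S).
Proof.
have stage_ex (X : pow S) : exists n,
    X \in cx_set (completion C S) -> X \in cx_set (iterate C n S).
  case: (pselect (exists n, X \in cx_set (iterate C n S))).
    by move=> [n nX]; exists n.
  (* Sets outside the completion get a default stage. *)
  by move=> no_n; exists 0%N => /completion_setP.
have [stage stageP] := fin_all_exists (T := pow S) (U := fun=> nat)
  (P := fun X n =>
          X \in cx_set (completion C S) -> X \in cx_set (iterate C n S))
  stage_ex.
exists (\max_X stage X)%N; apply/subsetP => X /stageP.
by apply/subsetP/iterate_le; apply: leq_bigmax.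
Qed.

(** Once the iterates have become constant at stage [n], this is the defining
    step from [n] to [n.+1]. *)
Lemma completion_step (C : complex_functor) (S : finSemigroupType)
    (XX : pow (completion C S)) :
  XX \in cx_set (C (completion C S)) ->
  cx_union XX \in cx_set (completion C S).
Proof.
have [n sub_n] := iterate_stationary C S => CXX.
apply/completion_setP; exists n.+1; apply/step_setP.
exists (pow_map (incl_map sub_n) XX); first exact: cf_restricts.
by rewrite cx_union_incl.
Qed.

(** A member of [iterate C m.+1 (D S)] lies under the union of a member [A] of
    [C (iterate C m (D S))]; by induction, union maps [iterate C m (D S)] into
    [D S], and so moves [A] into [C (D S)]. *)
Lemma iterate_union (C D : complex_functor) (S : finSemigroupType) :
  (forall XX : pow (D S),
     XX \in cx_set (C (D S)) -> cx_union XX \in cx_set (D S)) ->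
  forall m (XX : pow (D S)),
    XX \in cx_set (iterate C m (D S)) -> cx_union XX \in cx_set (D S).
Proof.
move=> stepD; elim=> [_ /imsetP[X _ ->]|m IHm XX /step_setP[A CA sXX]].
  by rewrite cx_union1; apply: valP.
apply: (complex_down (cxP (D S)) _ (cx_union_sub sXX)).
rewrite -(cx_union_union IHm); apply: stepD; exact: cf_restricts.
Qed.

Lemma completion_union_closed (C : complex_functor) :
  union_closed (completion C).
Proof.
move=> S XX /completion_setP[m mXX]; apply: iterate_union mXX.
exact: completion_step.
Qed.

Lemma completion_monad (C : complex_functor) :
  is_complex_monad (completion C).
Proof. exact/union_closedP/completion_union_closed. Qed.

Lemma completion_ge (C : complex_functor) : cf_le C (completion C).
Proof.
move=> S; apply/subsetP => X CX; apply/completion_setP; exists 1%N.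
apply/step_setP; exists (pow_map (unit_map (sing_complex S)) X).
  exact: cf_restricts.
by rewrite cx_union_unit.
Qed.

(** By induction each iterate lies below [D]: one step replaces an inclusion
    into [D S] by a union of a member of [D (D S)]. *)
Lemma completion_least (C D : complex_functor) :
  is_complex_monad D -> cf_le C D -> cf_le (completion C) D.
Proof.
move=> /union_closedP Dcl leCD S; apply/subsetP => X /completion_setP[n].
elim: n S X => [|n IHn] S X; first exact/subsetP/(complex_sing (cxP (D S))).
move=> /step_setP[A CA sX].
have sub_n : cx_set (iterate C n S) \subset cx_set (D S).
  by apply/subsetP => Y; apply: IHn.
apply: (complex_down (cxP (D S)) _ sX).
rewrite -(cx_union_incl sub_n); apply/Dcl/(subsetP (leCD _)).
exact: cf_restricts.
Qed.

Lemma completion_id (D : complex_functor) :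
  is_complex_monad D -> completion D = D.
Proof.
move=> Dm; apply: cf_le_anti (completion_ge D).
exact: completion_least Dm (cf_le_refl D).
Qed.

Lemma completion_closure : closure_operator cf_le completion.
Proof.
split=> [C D leCD|C|C]; last exact/completion_id/completion_monad.
  apply: completion_least (completion_monad D) _.
  exact: cf_le_trans leCD (completion_ge D).
exact: completion_ge.
Qed.

Lemma completion_image (C : complex_functor) :
  is_complex_monad C <-> exists D, completion D = C.
Proof.
split=> [Cm|[D <-]]; last exact: completion_monad.
by exists C; apply: completion_id.
Qed.

(** * The lattice of complex monads *)

Definition compl (C : complex_functor) : complex_monad :=
  ComplexMonad (completion_monad C).

Lemma compl_adjoint (C : complex_functor) (M : complex_monad) :
  cm_le (compl C) M <-> cf_le C M.
Proof.
split=> leCM; first exact: cf_le_trans (completion_ge C) leCM.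
exact: completion_least (cmP M) leCM.
Qed.

Lemma cm_join_lub (P : complex_monad -> Prop) :
  is_lub cm_le P (compl (cf_join (cm_image P))).
Proof.
have [ub_join least_join] := cf_joinP (cm_image P).
split=> [M PM|N ubN].
  apply: cf_le_trans (completion_ge _).
  by apply: ub_join; exists M.
by apply/compl_adjoint/least_join => _ [M PM <-]; apply: ubN.
Qed.

Lemma cm_lubE (P : complex_monad -> Prop) (M : complex_monad) :
  is_lub cm_le P M <-> cm_functor M = completion (cf_join (cm_image P)).
Proof.
split=> [lubM|eqM].
  by rewrite (lub_unique cm_le_order lubM (cm_join_lub P)).
have -> : M = compl (cf_join (cm_image P)) by apply: cm_functor_inj.
exact: cm_join_lub.
Qed.

(** A complex functor below the members of [P] has its completion below them
    too, so lower bounds in complex monads suffice to test a meet. *)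
Lemma cm_glbE (P : complex_monad -> Prop) (M : complex_monad) :
  is_glb cm_le P M <-> is_glb cf_le (cm_image P) M.
Proof.
split=> [[lbM glbM]|[lbM glbM]]; split.
- by move=> _ [N PN <-]; apply: lbM.
- move=> C lbC; apply/compl_adjoint/glbM => N PN.
  by apply/compl_adjoint/lbC; exists N.
- by move=> N PN; apply: lbM; exists N.
- by move=> N lbN; apply: glbM => _ [K PK <-]; apply: lbN.
Qed.

Lemma cm_complete_lattice : complete_lattice cm_le.
Proof.
apply: lubs_complete_lattice; first exact: cm_le_order.
move=> P; exists (compl (cf_join (cm_image P))); exact: cm_join_lub.
Qed.

(** * Fixed points and pseudovarieties *)

Lemma Fix_anti (C D : complex_functor) : cf_le C D -> pv_le (Fix D) (Fix C).
Proof.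
move=> leCD S /fix_classP DS; apply/fix_classP => X CX.
exact/DS/(subsetP (leCD S)).
Qed.

Lemma Fix_iterate (C : complex_functor) (n : nat) :
  pv_le (Fix C) (Fix (iterate C n)).
Proof.
elim: n => [|n IHn] S CS //; have nS := IHn S CS.
apply/fix_classP => X /step_setP[A CA sX].
(* All members of the complex are singletons, so it is a quotient of S. *)
have unit_surj : surjective (unit_map (iterate C n S)).
  move=> Y; have : val Y \in sing S by rewrite -nS; apply: valP.
  move=> /imsetP[x _ eqY].
  by exists x; apply: val_inj.
have /fix_classP/(_ A CA)/imsetP[Y _ eqA] :=
  pv_im (fix_is_pseudovariety C) unit_surj CS.
rewrite eqA cx_union1 in sX; rewrite -nS.
exact: (complex_down (cxP _) (valP Y) sX).
Qed.

Lemma Fix_completion (C : complex_functor) : Fix C = Fix (completion C).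
Proof.
apply: pv_ext => S; split=> [CS|]; last exact: Fix_anti (completion_ge C) S.
apply/fix_classP => X /completion_setP[n].
by have /fix_classP := Fix_iterate n CS; apply.
Qed.

(** The least complex of [S] is [sing S], so a pointwise join of complexes that
    are trivial at [S] is trivial at [S]. *)
Lemma pv_le_Fix_Max (V : pseudovariety) : pv_le V (Fix (Max V)).
Proof.
move=> S VS; apply/fix_classP => X /join_setP/(_ (sing_complex S)); apply.
by move=> C leVC; rewrite (leVC S VS).
Qed.

Lemma Fix_Max_adjoint (C : complex_functor) (V : pseudovariety) :
  pv_op_le (Fix C) V <-> cf_le C (Max V).
Proof.
split=> [leVC|leCM S VS]; first exact: (cf_joinP _).1.
exact/(Fix_anti leCM)/pv_le_Fix_Max.
Qed.

Lemma Max_anti (V W : pseudovariety) : pv_op_le V W -> cf_le (Max V) (Max W).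
Proof.
move=> leWV; apply/Fix_Max_adjoint => S WS.
exact/pv_le_Fix_Max/leWV.
Qed.

(** [Max V] is its own completion: completing does not change the fixed points,
    so by the adjunction it does not lead above [Max V]. *)
Lemma Max_monad (V : pseudovariety) : is_complex_monad (Max V).
Proof.
apply/completion_image; exists (Max V).
apply: cf_le_anti (completion_ge _); apply/Fix_Max_adjoint.
rewrite -Fix_completion; exact: pv_le_Fix_Max.
Qed.

Theorem mainTheorem2 :
  (* (1) *)
  (forall C : complex_functor, is_complex_monad (completion C)) /\
  (* (2) *)
  (closure_operator cf_le completion /\
   (forall C : complex_functor,
      is_complex_monad C <-> exists D : complex_functor, completion D = C) /\
   complete_lattice cm_le /\
   (forall (P : complex_monad -> Prop) (M : complex_monad),
      is_glb cm_le P M <-> is_glb cf_le (cm_image P) M) /\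
   (forall (P : complex_monad -> Prop) (M : complex_monad),
      is_lub cm_le P M <-> cm_functor M = completion (cf_join (cm_image P)))) /\
  (* (3) *)
  (forall C : complex_functor, Fix C = Fix (completion C)) /\
  (* (4) *)
  (complete_lattice cf_le /\ complete_lattice pv_op_le /\
   exists (compl : complex_functor -> complex_monad)
          (MaxM : pseudovariety -> complex_monad),
     (forall C : complex_functor, cm_functor (compl C) = completion C) /\
     surjective compl /\
     galois_connection cf_le cm_le compl cm_functor /\
     galois_connection cf_le pv_op_le Fix Max /\
     galois_connection cm_le pv_op_le
       (fun M : complex_monad => Fix (cm_functor M)) MaxM /\
     (* the triangles of lower and of upper adjoints commute *)
     (forall C : complex_functor, Fix (cm_functor (compl C)) = Fix C) /\
     (forall V : pseudovariety, cm_functor (MaxM V) = Max V)).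
Proof.
split; first exact: completion_monad.
split.
  split; first exact: completion_closure.
  split; first exact: completion_image.
  split; first exact: cm_complete_lattice.
  by split; [exact: cm_glbE | exact: cm_lubE].
split; first exact: Fix_completion.
split; first exact: cf_complete_lattice.
split; first exact: pv_op_complete_lattice.
exists compl, (fun V => ComplexMonad (Max_monad V)).
split=> //; split.
  by move=> M; exists M; apply/cm_functor_inj/completion_id/cmP.
split.
  by split=> [||C M]; [case: completion_closure | | exact: compl_adjoint].
split.
  by split; [exact: Fix_anti | exact: Max_anti | exact: Fix_Max_adjoint].
split.
  split=> [M N|V W|M V]; first exact: Fix_anti.
  - exact: Max_anti.
  - exact: Fix_Max_adjoint.
by split=> // C; rewrite -Fix_completion.
Qed.
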